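(* Let $H$ be a finite-dimensional Hopf algebra over a field $k$ with a nonzero left integral $t$, and let $A$ be a unital $k$-algebra with a symmetric partial action of $H$ such that $h\cdot 1_A$ is central in $A$ for every $h\in H$. Assume that the partial trace map $\hat t:A\to A^{\underline{H}}$, $\hat t(a)=t\cdot a$, is surjective. Then the Morita context between $A^{\underline{H}}$ and $\underline{A\# H}$ given by the bimodules ${}_{\underline{A\# H}}A_{A^{\underline{H}}}$ and ${}_{A^{\underline{H}}}A_{\underline{A\# H}}$ and the maps $[\cdot,\cdot]:A\otimes_{A^{\underline{H}}}A\to\underline{A\# H}$, $[a,b]=(\underline{a\# 1_H})(\underline{1_A\# t})(\underline{b\# 1_H})$, and $\langle\cdot,\cdot\rangle:A\otimes_{\underline{A\# H}}A\to A^{\underline{H}}$, $\langle a,b\rangle=t\cdot(ab)$, is strict (i.e. both maps $[\cdot,\cdot]$ and $\langle\cdot,\cdot\rangle$ are surjective) if and only if the extension $A^{\underline{H}}\subset A$ is partial $H^*$-Hopf Galois.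
   Context: Sweedler notation is used; $\epsilon$ is the counit, $S$ the antipode (bijective since $H$ is finite-dimensional). A left integral is $t\in H$ with $ht=\epsilon(h)t$ for all $h\in H$; $\alpha:H\to k$ is the algebra morphism with $th=\alpha(h)t$ for all $h\in H$. A partial action of a Hopf algebra $H$ on a unital algebra $A$ is a linear map $H\otimes A\to A$, $h\otimes a\mapsto h\cdot a$, with (i) $h\cdot(ab)=\sum(h_{(1)}\cdot a)(h_{(2)}\cdot b)$; (ii) $1_H\cdot a=a$; (iii) $h\cdot(g\cdot a)=\sum(h_{(1)}\cdot 1_A)((h_{(2)}g)\cdot a)$. It is symmetric if also (iv) $h\cdot(g\cdot a)=\sum((h_{(1)}g)\cdot a)(h_{(2)}\cdot 1_A)$. Partial invariants: $A^{\underline{H}}=\{a\in A: h\cdot a=a(h\cdot 1_A)\ \forall h\in H\}$, a subalgebra of $A$; $\hat t$ takes values in $A^{\underline{H}}$. Partial smash product: $A\otimes H$ is an associative algebra under $(a\otimes h)(b\otimes g)=\sum a(h_{(1)}\cdot b)\otimes h_{(2)}g$, and $\underline{A\# H}=(A\otimes H)(1_A\otimes 1_H)$, i.e. the span of the elements $\underline{a\# h}=\sum a(h_{(1)}\cdot 1_A)\otimes h_{(2)}$. Bimodule structures on $A$: $A^{\underline{H}}$ acts by left and right multiplication; $\underline{A\# H}$ acts on the left by $(\underline{a\# h})\rhd b=a(h\cdot b)$ and on the right by $b\lhd(\underline{a\# h})=\sum\alpha(h_{(2)})S^{-1}(h_{(1)})\cdot(ba)$. With these, the data above form a Morita context (the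 two maps are well-defined bimodule morphisms satisfying the associativity conditions $[a,b]\rhd c=a\langle b,c\rangle$, $a\lhd[b,c]=\langle a,b\rangle c$). Induced partial $H^*$-coaction: for a basis $\{h_i\}$ of $H$ with dual basis $\{h_i^*\}$, $\overline{\rho}:A\to A\otimes H^*$, $\overline{\rho}(a)=\sum_i(h_i\cdot a)\otimes h_i^*=\sum a^{[0]}\otimes a^{[1]}$. $A\otimes H^*$ is an $A$–$A$ bimodule by left multiplication and $(a\otimes f)b=\sum ab^{[0]}\otimes fb^{[1]}$ (convolution product in $H^*$), and $\underline{A\otimes H^*}=(A\otimes H^* )1_A$ is the sub-bimodule spanned by the elements $\sum a1_A^{[0]}\otimes f1_A^{[1]}$. The coinvariants $\{a\in A:\overline{\rho}(a)=a\overline{\rho}(1_A)\}$ coincide with $A^{\underline{H}}$. The extension $A^{\underline{H}}\subset A$ is partial $H^*$-Hopf Galois if the canonical map $\beta:A\otimes_{A^{\underline{H}}}A\to\underline{A\otimes H^*}$, $\beta(a\otimes b)=\sum ab^{[0]}\otimes b^{[1]}$, is a bijective $A$–$A$ bimodule morphism. *)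

(* Defs.v *)
From HB Require Import structures.
From mathcomp Require Import all_boot all_order all_algebra all_field.
From mathcomp Require Import boolp classical_sets functions.

Set Implicit Arguments.
Unset Strict Implicit.
Unset Printing Implicit Defensive.

Import GRing.Theory.
Local Open Scope ring_scope.
Local Open Scope classical_set_scope.
Local Open Scope quotient_scope.

(* The tensor product of M and N balanced over scalars R acting on M from the
   right and on N from the left: finite formal sums of pairs modulo the least
   additive congruence making (m, n) |-> [:: (m, n)] biadditive and balanced.
   No formal opposites are needed, since - (m, n) is represented by (- m, n). *)
Section TensorCongruence.
Variables (M N : zmodType) (R : Type) (ract : M -> R -> M) (lact : R -> N -> N).

Inductive tensor_eq : seq (M * N) -> seq (M * N) -> Prop :=
| tensor_eq_refl x : tensor_eq x x
| tensor_eq_sym x y : tensor_eq x y -> tensor_eq y x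
| tensor_eq_trans y x z : tensor_eq x y -> tensor_eq y z -> tensor_eq x z
| tensor_eq_cat x x' y y' :
    tensor_eq x x' -> tensor_eq y y' -> tensor_eq (x ++ y) (x' ++ y')
| tensor_eq_catC x y : tensor_eq (x ++ y) (y ++ x)
| tensor_eq_0l n : tensor_eq [:: (0, n)] [::]
| tensor_eq_0r m : tensor_eq [:: (m, 0)] [::]
| tensor_eq_Dl m m' n : tensor_eq [:: (m + m', n)] [:: (m, n); (m', n)]
| tensor_eq_Dr m n n' : tensor_eq [:: (m, n + n')] [:: (m, n); (m, n')]
| tensor_eq_bal m r n : tensor_eq [:: (ract m r, n)] [:: (m, lact r n)].

Definition tensor_rel (x y : seq (M * N)) : bool := `[< tensor_eq x y >].

Lemma tensor_rel_equiv : equiv_class_of tensor_rel.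
Proof.
split=> [x|x y|y x z]; first exact/asboolP/tensor_eq_refl.
  by apply/asboolP/asboolP; apply: tensor_eq_sym.
by move=> /asboolP xy /asboolP yz; apply/asboolP; apply: tensor_eq_trans yz.
Qed.

Canonical tensor_equivRel := EquivRelPack tensor_rel_equiv.

Definition tensor := {eq_quot tensor_rel}.

HB.instance Definition _ := Choice.on tensor.
HB.instance Definition _ := EqQuotient.on tensor.

Definition tens (m : M) (n : N) : tensor := \pi_tensor [:: (m, n)].

Lemma tensor_piP x y : \pi_tensor x = \pi_tensor y <-> tensor_eq x y.
Proof. by split=> [/eqmodP/asboolP //|xy]; apply/eqmodP/asboolP. Qed.

Lemma tensor_reprK x : tensor_eq (repr (\pi_tensor x)) x.
Proof. by apply/tensor_piP; rewrite reprK. Qed.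

Definition tensor_zero : tensor := \pi_tensor [::].
Definition tensor_add (x y : tensor) : tensor := \pi_tensor (repr x ++ repr y).
Definition tensor_opp (x : tensor) : tensor :=
  \pi_tensor [seq (- p.1, p.2) | p <- repr x].

Lemma tensor_addE x y :
  tensor_add (\pi_tensor x) (\pi_tensor y) = \pi_tensor (x ++ y).
Proof. by apply/tensor_piP; apply: tensor_eq_cat; apply: tensor_reprK. Qed.

Lemma tensor_addA : associative tensor_add.
Proof.
move=> x y z; rewrite -[x]reprK -[y]reprK -[z]reprK.
rewrite (tensor_addE (repr y)) (tensor_addE (repr x)).
by rewrite (tensor_addE (repr x)) (tensor_addE (_ ++ _)) catA.
Qed.

Lemma tensor_addC : commutative tensor_add.
Proof.
move=> x y; rewrite -[x]reprK -[y]reprK !tensor_addE.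
exact/tensor_piP/tensor_eq_catC.
Qed.

Lemma tensor_add0 : left_id tensor_zero tensor_add.
Proof. by move=> x; rewrite -[x]reprK tensor_addE. Qed.

Lemma tensor_addN : left_inverse tensor_zero tensor_opp tensor_add.
Proof.
move=> x; rewrite -{2}[x]reprK tensor_addE.
apply/tensor_piP; elim: (repr x) => [|[m n] s IHs] /=.
  exact: tensor_eq_refl.
apply: (@tensor_eq_trans
  (([:: (- m, n)] ++ [:: (m, n)]) ++ ([seq (- p.1, p.2) | p <- s] ++ s))).
  rewrite -catA -cat1s; apply: tensor_eq_cat; first exact: tensor_eq_refl.
  rewrite -[(m, n) :: s]cat1s !catA.
  apply: tensor_eq_cat; last exact: tensor_eq_refl.
  exact: tensor_eq_catC.
rewrite -[[::]]cats0; apply: tensor_eq_cat => //.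
apply: (tensor_eq_trans _ (tensor_eq_0l n)).
by rewrite -(addNr m); apply/tensor_eq_sym/tensor_eq_Dl.
Qed.

HB.instance Definition _ := GRing.isZmodule.Build tensor
  tensor_addA tensor_addC tensor_add0 tensor_addN.

Definition balanced (V : zmodType) (f : M -> N -> V) :=
  [/\ forall m m' n, f (m + m') n = f m n + f m' n,
      forall m n n', f m (n + n') = f m n + f m n'
    & forall m r n, f (ract m r) n = f m (lact r n)].

Lemma tens_balanced : balanced tens.
Proof.
split=> [m m' n|m n n'|m r n].
- by rewrite [RHS]tensor_addE; apply/tensor_piP/tensor_eq_Dl.
- by rewrite [RHS]tensor_addE; apply/tensor_piP/tensor_eq_Dr.
- exact/tensor_piP/tensor_eq_bal.
Qed.

Lemma tensor_reprE x : x = \sum_(p <- repr x) tens p.1 p.2.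
Proof.
rewrite -{1}[x]reprK; elim: (repr x) => [|[m n] s IHs]; first by rewrite big_nil.
by rewrite big_cons -IHs [RHS]tensor_addE.
Qed.

(* The map induced on the tensor product by f, sending sum_i m_i (x) n_i to
   sum_i f m_i n_i. It is total, and has this meaning when f is balanced, see
   tensor_lift_tens and tensor_liftD; it is then the only additive map
   extending f, by tensor_lift_uniq. *)
Definition tensor_lift (V : zmodType) (f : M -> N -> V) (x : tensor) : V :=
  \sum_(p <- repr x) f p.1 p.2.

Section Lift.
Variables (V : zmodType) (f : M -> N -> V).
Hypothesis f_bal : balanced f.

Lemma balanced_sum_eq x y : tensor_eq x y ->
  \sum_(p <- x) f p.1 p.2 = \sum_(p <- y) f p.1 p.2.
Proof.
have [fDl fDr fb] := f_bal.
elim=> // {x y} [y x z _ -> _ -> //|x x' y y' _ xx' _ yy'|x y|n|m|m m' n|m n n'|m r n].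
- by rewrite !big_cat xx' yy'.
- by rewrite !big_cat /= addrC.
- rewrite big_seq1 big_nil /=.
  by apply: (addIr (f 0 n)); rewrite -fDl addr0 add0r.
- rewrite big_seq1 big_nil /=.
  by apply: (addIr (f m 0)); rewrite -fDr addr0 add0r.
- by rewrite !big_cons !big_nil /= !addr0 ?fDl ?fDr.
- by rewrite !big_cons !big_nil /= !addr0 ?fDl ?fDr.
- by rewrite !big_seq1 /= fb.
Qed.

Lemma tensor_lift_pi x : tensor_lift f (\pi_tensor x) = \sum_(p <- x) f p.1 p.2.
Proof. by apply: balanced_sum_eq; apply: tensor_reprK. Qed.

Lemma tensor_lift_tens m n : tensor_lift f (tens m n) = f m n.
Proof. by rewrite tensor_lift_pi big_seq1. Qed.

Lemma tensor_liftD x y :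
  tensor_lift f (x + y) = tensor_lift f x + tensor_lift f y.
Proof.
rewrite -[x]reprK -[y]reprK.
by rewrite [\pi_tensor (repr x) + _]tensor_addE !tensor_lift_pi big_cat.
Qed.

Lemma tensor_lift_uniq (F : tensor -> V) :
    {morph F : x y / x + y} -> (forall m n, F (tens m n) = f m n) ->
  F =1 tensor_lift f.
Proof.
move=> FD Ft x; rewrite /tensor_lift {1}[x]tensor_reprE.
have F0 : F 0 = 0 by apply: (addIr (F 0)); rewrite -FD !add0r.
by rewrite (big_morph F FD F0); apply: eq_bigr.
Qed.

End Lift.
End TensorCongruence.

Arguments tens {M N R ract lact} m n.

(* U (x) V over the field k, with its vector space structure. *)
Section TensorField.
Variables (k : fieldType) (U V : lmodType k).

Definition kract (u : U) (c : k) := c *: u.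
Definition klact (c : k) (v : V) := c *: v.

Definition ktensor := tensor kract klact.

HB.instance Definition _ := GRing.Zmodule.on ktensor.

Definition ktens (u : U) (v : V) : ktensor := tens u v.

Lemma ktensDl u u' v : ktens (u + u') v = ktens u v + ktens u' v.
Proof. by have [tE _ _] := tens_balanced kract klact; apply: tE. Qed.

Lemma ktensDr u v v' : ktens u (v + v') = ktens u v + ktens u v'.
Proof. by have [_ tE _] := tens_balanced kract klact; apply: tE. Qed.

Lemma ktensZ c u v : ktens (c *: u) v = ktens u (c *: v).
Proof. by have [_ _ tE] := tens_balanced kract klact; apply: tE. Qed.

Definition ktensor_scale (c : k) : ktensor -> ktensor :=
  tensor_lift (fun u v => ktens (c *: u) v).

Lemma ktensor_scale_balanced c :
  balanced kract klact (fun u v => ktens (c *: u) v).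
Proof.
split=> [u u' v|u v v'|u d v]; rewrite ?scalerDr ?ktensDl ?ktensDr //.
by rewrite /kract scalerA mulrC -scalerA ktensZ.
Qed.

Lemma ktensor_ind (P : ktensor -> Prop) : P 0 ->
  (forall u v x, P x -> P (ktens u v + x)) -> forall x, P x.
Proof.
move=> P0 PS x; rewrite [x]tensor_reprE.
by elim: (repr x) => [|[u v] s IHs]; rewrite ?big_nil ?big_cons //; apply: PS.
Qed.

Lemma ktensor_scaleD c : {morph ktensor_scale c : x y / x + y}.
Proof. exact/tensor_liftD/ktensor_scale_balanced. Qed.

Lemma ktensor_scale0 c : ktensor_scale c 0 = 0.
Proof. by apply: (addIr (ktensor_scale c 0)); rewrite -ktensor_scaleD !add0r. Qed.

Lemma ktensor_scaleE c u v : ktensor_scale c (ktens u v) = ktens (c *: u) v.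
Proof. exact/tensor_lift_tens/ktensor_scale_balanced. Qed.

Lemma ktensor_scaleA a b x :
  ktensor_scale a (ktensor_scale b x) = ktensor_scale (a * b) x.
Proof.
elim/ktensor_ind: x => [|u v x IHx]; first by rewrite !ktensor_scale0.
by rewrite !ktensor_scaleD IHx !ktensor_scaleE scalerA.
Qed.

Lemma ktensor_scale1 : left_id 1 ktensor_scale.
Proof.
elim/ktensor_ind => [|u v x IHx]; first by rewrite ktensor_scale0.
by rewrite ktensor_scaleD IHx ktensor_scaleE scale1r.
Qed.

Lemma ktensor_scaleDl x : {morph ktensor_scale^~ x : a b / a + b}.
Proof.
move=> a b; elim/ktensor_ind: x => [|u v x IHx].
  by rewrite !ktensor_scale0 addr0.
by rewrite !ktensor_scaleD IHx !ktensor_scaleE scalerDl ktensDl addrACA.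
Qed.

HB.instance Definition _ := GRing.Zmodule_isLmodule.Build k ktensor
  ktensor_scaleA ktensor_scale1 ktensor_scaleD ktensor_scaleDl.

End TensorField.

Section HopfAlgebra.
Variables (k : fieldType) (H : falgType k).

Definition ktensor_mul (x y : ktensor H H) : ktensor H H :=
  tensor_lift (fun a b => tensor_lift (fun c d => ktens (a * c) (b * d)) y) x.

Record hopfAlgebra := HopfAlgebra {
  comul : {linear H -> ktensor H H};
  counit : {lrmorphism H -> k^o};
  antipode : {linear H -> H};
  comul1 : comul 1 = ktens 1 1;
  comulM : forall g h, comul (g * h) = ktensor_mul (comul g) (comul h);
  coassoc : forall h,
    tensor_lift (fun a b =>
      tensor_lift (fun a1 a2 => ktens a1 (ktens a2 b)) (comul a)) (comul h)
    = tensor_lift (fun a b =>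
        tensor_lift (fun b1 b2 => ktens a (ktens b1 b2)) (comul b)) (comul h);
  counitl : forall h,
    tensor_lift (fun a b => (counit a : k) *: b) (comul h) = h;
  counitr : forall h,
    tensor_lift (fun a b => (counit b : k) *: a) (comul h) = h;
  antipodel : forall h,
    tensor_lift (fun a b => antipode a * b) (comul h) = (counit h : k) *: 1;
  antipoder : forall h,
    tensor_lift (fun a b => a * antipode b) (comul h) = (counit h : k) *: 1
}.

Variable D : hopfAlgebra.

(* sum f h_(1) h_(2) in Sweedler notation, for bilinear f. *)
Definition sweedler (V : lmodType k) (h : H) (f : H -> H -> V) : V :=
  tensor_lift f (comul D h).

(* The antipode of a finite-dimensional Hopf algebra is bijective, so that the
   right inverse on the image provided by (_^-1)%VF is its inverse. *)
Definition antipode_inv : 'End(H) := ((linfun (antipode D))^-1)%VF.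

Definition left_integral (t : H) := forall h, h * t = (counit D h : k) *: t.

Definition dual := 'Hom(H, k^o).

(* The product dual to comul. *)
Definition convolution (f g : dual) : dual :=
  linfun (fun h => sweedler h (fun h1 h2 => f h1 * g h2 : k^o)).

End HopfAlgebra.

Section PartialAction.
Variables (k : fieldType) (H : falgType k) (D : hopfAlgebra H) (A : algType k).

Record partialAction := PartialAction {
  pact :> H -> A -> A;
  pact_linearl : forall a, linear (pact^~ a);
  pact_linearr : forall h, linear (pact h);
  pactM : forall h a b,
    pact h (a * b) = sweedler D h (fun h1 h2 => pact h1 a * pact h2 b);
  pact1 : forall a, pact 1 a = a;
  pactA : forall h g a, pact h (pact g a) =
    sweedler D h (fun h1 h2 => pact h1 1 * pact (h2 * g) a)
}.

Variable P : partialAction.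

Definition symmetric_action := forall h g a,
  P h (P g a) = sweedler D h (fun h1 h2 => P (h1 * g) a * P h2 1).

Definition invariants : set A := [set a | forall h, P h a = a * P h 1].

Definition smash_mul (x y : ktensor A H) : ktensor A H :=
  tensor_lift (fun a h => tensor_lift (fun b g =>
    sweedler D h (fun h1 h2 => ktens (a * P h1 b) (h2 * g))) y) x.

(* The image of a (x) h in the partial smash product. *)
Definition smash_elt (a : A) (h : H) : ktensor A H :=
  smash_mul (ktens a h) (ktens 1 1).

Definition smash : set (ktensor A H) := range (smash_mul^~ (ktens 1 1)).

(* The left and right actions of the partial smash product on A. Both are
   given by formulas on A (x) H whose values at smash_elt a h and at ktens a h
   are the same. *)
Definition smash_lact (x : ktensor A H) (b : A) : A :=
  tensor_lift (fun a h => a * P h b) x.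

Definition smash_ract (alpha : H -> k) (b : A) (x : ktensor A H) : A :=
  tensor_lift (fun a h => sweedler D h (fun h1 h2 =>
    alpha h2 *: P (antipode_inv D h1) (b * a))) x.

Definition invariants_tensor :=
  tensor (fun (a : A) (c : {c : A | invariants c}) => a * sval c)
         (fun (c : {c : A | invariants c}) (b : A) => sval c * b).

Definition smash_tensor (alpha : H -> k) :=
  tensor (fun (a : A) (x : {x | smash x}) => smash_ract alpha a (sval x))
         (fun (x : {x | smash x}) (b : A) => smash_lact (sval x) b).

Definition morita_bracket (t : H) : invariants_tensor -> ktensor A H :=
  tensor_lift (fun a b =>
    smash_mul (smash_mul (smash_elt a 1) (smash_elt 1 t)) (smash_elt b 1)).

Definition morita_pairing (t : H) (alpha : H -> k) : smash_tensor alpha -> A :=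
  tensor_lift (fun a b => P t (a * b)).

Definition morita_strict (t : H) (alpha : H -> k) :=
  set_surj [set: invariants_tensor] smash (morita_bracket t) /\
  set_surj [set: smash_tensor alpha] invariants (@morita_pairing t alpha).

(* The coaction does not depend on the basis used to write it. *)
Definition coaction (a : A) : ktensor A (dual H) :=
  \sum_(i < \dim {:H})
    ktens (P (vbasis {:H})`_i a) (linfun (coord (vbasis {:H}) i : H -> k^o) : dual H).

Definition coact_lmul (a : A) (x : ktensor A (dual H)) : ktensor A (dual H) :=
  tensor_lift (fun b f => ktens (a * b) f) x.

Definition coact_rmul (x : ktensor A (dual H)) (b : A) : ktensor A (dual H) :=
  tensor_lift (fun a f =>
    tensor_lift (fun b0 b1 => ktens (a * b0) (convolution D f b1))
      (coaction b)) x.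

Definition coact_bimodule : set (ktensor A (dual H)) :=
  range (coact_rmul^~ 1).

Definition invariants_lmul (a : A) (x : invariants_tensor) : invariants_tensor :=
  tensor_lift (fun b c => tens (a * b) c) x.

Definition invariants_rmul (x : invariants_tensor) (a : A) : invariants_tensor :=
  tensor_lift (fun b c => tens b (c * a)) x.

Definition galois_map : invariants_tensor -> ktensor A (dual H) :=
  tensor_lift (fun a b => coact_lmul a (coaction b)).

Definition partial_hopf_galois :=
  [/\ {morph galois_map : x y / x + y},
      forall a x, galois_map (invariants_lmul a x) = coact_lmul a (galois_map x),
      forall x a, galois_map (invariants_rmul x a) = coact_rmul (galois_map x) a
    & set_bij [set: invariants_tensor] coact_bimodule galois_map].

End PartialAction.

(* Main.v *)
Require Import Defs.
From HB Require Import structures.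
From mathcomp Require Import all_boot all_order all_algebra all_field.
From mathcomp Require Import boolp classical_sets functions.
Import GRing.Theory.
Local Open Scope ring_scope.
Local Open Scope classical_set_scope.

(** Write [eval_at h] for the map [a (x) f |-> f h *: a] on [A (x) H^*], so that
    [eval_at h (galois_map (a (x) b)) = a (h . b)]. Slicing the integral,
    [Theta x = sum eval_at t_1 x (x) t_2] maps [A (x) H^*] to [A (x) H], carries
    [coact_bimodule P] to [smash P], and satisfies [[a, b] = Theta (galois_map (a (x) b))].

    [Theta] is bijective because [t] is a Frobenius element: the elements
    [f(t_1) t_2] form a left ideal and a coideal, hence all of [H], which gives
    [lam] with [lam(t_1) t_2 = 1]. Then [h |-> lam(S(h) -)] inverts the slicing,
    and [S^-1 g = lam(g t_1) t_2].

    So the bracket is onto iff the canonical map is onto. The pairing is onto by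
    surjectivity of the trace, and when the bracket is onto, writing
    [1 (x) 1 = sum [a_i, b_i]] gives [y = sum t.(y a_i) b_i] for all [y], so that
    [x (x) y = sum x (t.(y a_i)) (x) b_i] is determined by [galois_map (x (x) y)]. *)

Set Implicit Arguments.
Unset Strict Implicit.
Unset Printing Implicit Defensive.

(** * Linear maps and tensor products *)

Section Linearity.
Variable k : fieldType.
Implicit Types U V W : lmodType k.

(** A predicate on bare functions, so that the anonymous maps inside Sweedler sums can be treated
    without building bundled linear structures; [lin] below proves it from the shape of the term. *)
Definition is_linear U V (f : U -> V) :=
  forall c x y, f (c *: x + y) = c *: f x + f y.

Definition is_bilinear U V W (f : U -> V -> W) :=
  (forall v, is_linear (f^~ v)) /\ (forall u, is_linear (f u)).

Lemma is_linear0 U V (f : U -> V) : is_linear f -> f 0 = 0.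
Proof. by move=> fL; have := fL (-1) 0 0; rewrite !scaleN1r !addNr. Qed.

Lemma is_linearD U V (f : U -> V) : is_linear f -> {morph f : x y / x + y}.
Proof. by move=> fL x y; have := fL 1 x y; rewrite !scale1r. Qed.

Lemma is_linearZ U V (f : U -> V) c x : is_linear f -> f (c *: x) = c *: f x.
Proof. by move=> fL; have := fL c x 0; rewrite (is_linear0 fL) !addr0. Qed.

Lemma is_linear_sum U V (f : U -> V) I (r : seq I) (E : I -> U) :
  is_linear f -> f (\sum_(i <- r) E i) = \sum_(i <- r) f (E i).
Proof. by move=> fL; rewrite (big_morph f (is_linearD fL) (is_linear0 fL)). Qed.

Lemma linearP_is_linear U V (f : {linear U -> V}) : is_linear f.
Proof. exact: linearP. Qed.

Lemma is_linear_id U : is_linear (fun x : U => x).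
Proof. by []. Qed.

Lemma is_linear_comp U V W (g : V -> W) (f : U -> V) :
  is_linear g -> is_linear f -> is_linear (fun x => g (f x)).
Proof. by move=> gL fL c x y; rewrite fL gL. Qed.

Lemma is_linear_mull U (B : algType k) (f : U -> B) (b : B) :
  is_linear f -> is_linear (fun x => f x * b).
Proof. by move=> fL c x y; rewrite fL mulrDl scalerAl. Qed.

Lemma is_linear_mulr U (B : algType k) (f : U -> B) (b : B) :
  is_linear f -> is_linear (fun x => b * f x).
Proof. by move=> fL c x y; rewrite fL mulrDr scalerAr. Qed.

Lemma is_linear_scalel U V (f : U -> k^o) (v : V) :
  is_linear f -> is_linear (fun x => (f x : k) *: v).
Proof. by move=> fL c x y; rewrite fL scalerDl scalerA. Qed.

Lemma is_linear_scaler U V (f : U -> V) (c : k) :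
  is_linear f -> is_linear (fun x => c *: f x).
Proof. by move=> fL d x y; rewrite fL scalerDr !scalerA mulrC. Qed.

Lemma is_linear_big U V I (r : seq I) (f : I -> U -> V) :
  (forall i, is_linear (f i)) -> is_linear (fun x => \sum_(i <- r) f i x).
Proof.
move=> fL c x y; rewrite scaler_sumr -big_split.
by apply: eq_bigr => i _; apply: fL.
Qed.

Lemma ktensZl U V c (u : U) (v : V) : ktens (c *: u) v = c *: ktens u v.
Proof. by symmetry; apply: ktensor_scaleE. Qed.

Lemma ktensZr U V c (u : U) (v : V) : ktens u (c *: v) = c *: ktens u v.
Proof. by rewrite -ktensZ ktensZl. Qed.

Lemma is_linear_ktensl U V W (f : W -> U) (v : V) :
  is_linear f -> is_linear (fun x => ktens (f x) v).
Proof. by move=> fL c x y; rewrite fL ktensDl ktensZl. Qed.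

Lemma is_linear_ktensr U V W (f : W -> V) (u : U) :
  is_linear f -> is_linear (fun x => ktens u (f x)).
Proof. by move=> fL c x y; rewrite fL ktensDr ktensZr. Qed.

Lemma is_bilinear_balanced U V W (f : U -> V -> W) :
  is_bilinear f -> balanced (@kract k U) (@klact k V) f.
Proof.
case=> fl fr; split=> [u u' v|u v v'|u c v].
- exact: (is_linearD (fl v)).
- exact: (is_linearD (fr u)).
- by rewrite (is_linearZ c u (fl v)) (is_linearZ c v (fr u)).
Qed.

Lemma lift_ktens U V W (f : U -> V -> W) u v :
  is_bilinear f -> tensor_lift f (ktens u v) = f u v.
Proof. by move/is_bilinear_balanced=> fB; apply: tensor_lift_tens. Qed.

Lemma is_linear_lift U V W (f : U -> V -> W) :
  is_bilinear f -> is_linear (tensor_lift f : ktensor U V -> W).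
Proof.
move=> fL c x y; have fB := is_bilinear_balanced fL.
have fD : {morph (tensor_lift f : ktensor U V -> W) : x y / x + y}.
  exact: tensor_liftD.
have f0 : tensor_lift f (0 : ktensor U V) = 0.
  by apply: (addIr (tensor_lift f (0 : ktensor U V))); rewrite -fD !add0r.
rewrite fD; congr (_ + _).
elim/ktensor_ind: x => [|u v x IHx]; first by rewrite !scaler0 f0 scaler0.
rewrite scalerDr !fD IHx -ktensZl !lift_ktens // scalerDr.
by case: fL => fl _; rewrite (is_linearZ c u (fl v)).
Qed.

End Linearity.

(** * Sweedler calculus *)

Section Sweedler.
Variables (k : fieldType) (H : falgType k) (D : hopfAlgebra H).
Implicit Types (U V W : lmodType k) (g h : H).

Definition is_trilinear V (f : H -> H -> H -> V) :=
  [/\ forall b c, is_linear (fun a => f a b c),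
      forall a c, is_linear (fun b => f a b c)
    & forall a b, is_linear (f a b)].

Lemma eq_sweedler V h (f g : H -> H -> V) :
  (forall a b, f a b = g a b) -> sweedler D h f = sweedler D h g.
Proof. by move=> fg; apply: eq_bigr => p _; apply: fg. Qed.

(** A Sweedler sum is literally a finite sum over one fixed representative of [comul D h], so [f]
    can be arbitrary here. Bilinearity enters once [h] varies or its coproduct is rewritten. *)
Lemma sweedler_linear V W (G : V -> W) h (f : H -> H -> V) : is_linear G ->
  G (sweedler D h f) = sweedler D h (fun a b => G (f a b)).
Proof. by move=> GL; apply: is_linear_sum. Qed.

Lemma sweedler_exchange V g h (f : H -> H -> H -> H -> V) :
  sweedler D g (fun a b => sweedler D h (f a b)) =
  sweedler D h (fun c d => sweedler D g (fun a b => f a b c d)).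
Proof. exact: exchange_big. Qed.

Lemma is_linear_sweedler V (f : H -> H -> V) :
  is_bilinear f -> is_linear (fun h => sweedler D h f).
Proof.
by move=> fL c x y; rewrite /sweedler linearP; apply: (is_linear_lift fL).
Qed.

Lemma is_linear_sweedler_fun U V h (f : U -> H -> H -> V) :
    (forall a b, is_linear (fun u => f u a b)) ->
  is_linear (fun u => sweedler D h (f u)).
Proof. by move=> fL; apply: is_linear_big => p; apply: fL. Qed.

Lemma is_bilinear_ktens U V : is_bilinear (@ktens k U V).
Proof.
split=> u; [apply: (is_linear_ktensl (f := id)) | apply: (is_linear_ktensr (f := id))];
  exact: is_linear_id.
Qed.

Lemma sweedler1 V (f : H -> H -> V) : is_bilinear f -> sweedler D 1 f = f 1 1.
Proof. by move=> fL; rewrite /sweedler comul1; apply: lift_ktens. Qed.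

Lemma sweedlerM V g h (f : H -> H -> V) : is_bilinear f ->
  sweedler D (g * h) f =
  sweedler D g (fun a b => sweedler D h (fun c d => f (a * c) (b * d))).
Proof.
move=> fL; rewrite /sweedler comulM /ktensor_mul.
have fl : is_linear (tensor_lift f : ktensor H H -> V) by apply: is_linear_lift.
rewrite [LHS](is_linear_sum _ _ fl); apply: eq_bigr => p _.
rewrite [LHS](is_linear_sum _ _ fl); apply: eq_bigr => q _.
exact: lift_ktens.
Qed.

Lemma sweedler_counitl V h (G : H -> V) : is_linear G ->
  sweedler D h (fun a b => (counit D a : k) *: G b) = G h.
Proof.
move=> GL; rewrite -[in RHS](counitl D h) -/(sweedler D h _) (sweedler_linear _ _ GL).
by apply: eq_sweedler => a b; rewrite (is_linearZ _ _ GL).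
Qed.

Lemma sweedler_counitr V h (G : H -> V) : is_linear G ->
  sweedler D h (fun a b => (counit D b : k) *: G a) = G h.
Proof.
move=> GL; rewrite -[in RHS](counitr D h) -/(sweedler D h _) (sweedler_linear _ _ GL).
by apply: eq_sweedler => a b; rewrite (is_linearZ _ _ GL).
Qed.

Lemma sweedler_antipodel V h (G : H -> V) : is_linear G ->
  sweedler D h (fun a b => G (antipode D a * b)) = (counit D h : k) *: G 1.
Proof.
move=> GL; rewrite -(is_linearZ _ _ GL) -(antipodel D h) -/(sweedler D h _).
by rewrite (sweedler_linear _ _ GL).
Qed.

Lemma sweedler_antipoder V h (G : H -> V) : is_linear G ->
  sweedler D h (fun a b => G (a * antipode D b)) = (counit D h : k) *: G 1.
Proof.
move=> GL; rewrite -(is_linearZ _ _ GL) -(antipoder D h) -/(sweedler D h _).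
by rewrite (sweedler_linear _ _ GL).
Qed.

(** A trilinear [f] induces a linear map [F] on the nested tensor product, and [F] is applied to the
    axiom [coassoc]. *)
Lemma sweedler_coassoc V h (f : H -> H -> H -> V) : is_trilinear f ->
  sweedler D h (fun a b => sweedler D a (fun a1 a2 => f a1 a2 b)) =
  sweedler D h (fun a b => sweedler D b (fun b1 b2 => f a b1 b2)).
Proof.
move=> [f1 f2 f3].
have fa a : is_bilinear (f a) by split=> u; [apply: f2 | apply: f3].
pose F : ktensor H (ktensor H H) -> V := tensor_lift (fun a => tensor_lift (f a)).
have FB : is_bilinear (fun a => tensor_lift (f a) : ktensor H H -> V).
  split=> [x|a]; last exact: is_linear_lift.
  by apply: is_linear_big => p; apply: f1.
have FL : is_linear F by apply: is_linear_lift.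
have Fk a b c : F (ktens a (ktens b c)) = f a b c.
  by rewrite /F [LHS](lift_ktens _ _ FB); apply: lift_ktens.
have := congr1 F (coassoc D h); rewrite -/(sweedler D h _) -/(sweedler D h _).
rewrite !(sweedler_linear _ _ FL) => E.
transitivity (sweedler D h (fun a b => F (sweedler D a (fun a1 a2 => ktens a1 (ktens a2 b))))).
  by apply: eq_sweedler => a b; rewrite (sweedler_linear _ _ FL); apply: eq_sweedler.
rewrite [LHS]E.
apply: eq_sweedler => a b; rewrite -/(sweedler D b _) (sweedler_linear _ _ FL).
exact: eq_sweedler.
Qed.
End Sweedler.

Lemma is_linear_sweedler_arg (k : fieldType) (H : falgType k) (D : hopfAlgebra H)
    (U V : lmodType k) (g : U -> H) (f : H -> H -> V) :
  is_linear g -> is_bilinear f -> is_linear (fun u => sweedler D (g u) f).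
Proof. by move=> gL fL; apply: (is_linear_comp (is_linear_sweedler D fL) gL). Qed.

Lemma is_linear_pactl (k : fieldType) (H : falgType k) (D : hopfAlgebra H)
    (A : algType k) (P : partialAction D A) a : is_linear (fun h => P h a).
Proof. by move=> c g h; apply: (pact_linearl P a c g h). Qed.

Lemma is_linear_pactr (k : fieldType) (H : falgType k) (D : hopfAlgebra H)
    (A : algType k) (P : partialAction D A) h : is_linear (P h).
Proof. by move=> c a b; apply: (pact_linearr P h c a b). Qed.

Lemma is_linear_lift_fun (k : fieldType) (U V W X : lmodType k)
    (y : ktensor V W) (f : X -> V -> W -> U) :
    (forall a b, is_linear (fun x => f x a b)) ->
  is_linear (fun x => tensor_lift (f x) y).
Proof. by move=> fL; apply: is_linear_big => p; apply: fL. Qed.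

(** Discharges linearity side conditions by descending through the term; bilinear and trilinear
    goals are first split into one goal per variable. *)
Ltac lin :=
  cbn beta;
  first
    [ assumption
    | match goal with
      | |- is_bilinear _ => split=> ?; lin
      | |- is_trilinear _ => split=> ? ?; lin
      | |- forall _, _ => intro; lin
      end
    | exact: is_linear_id
    | exact: linearP_is_linear
    | match goal with
      | |- is_linear (fun x => @?f x * ?b) => apply: (@is_linear_mull _ _ _ f b); lin
      | |- is_linear (fun x => ?b * @?f x) => apply: (@is_linear_mulr _ _ _ f b); lin
      | |- is_linear (fun x => ?c *: @?f x) => apply: (@is_linear_scaler _ _ _ f c); lin
      | |- is_linear (fun x => @?f x *: ?c) => apply: (@is_linear_scalel _ _ _ f c); lin
      | |- is_linear (fun x => ktens (@?f x) ?c) => apply: (@is_linear_ktensl _ _ _ _ f c); lin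
      | |- is_linear (fun x => ktens ?c (@?f x)) => apply: (@is_linear_ktensr _ _ _ _ f c); lin
      | |- is_linear (fun x => sweedler ?D ?h (fun a b => @?f x a b)) =>
          apply: (@is_linear_sweedler_fun _ _ D _ _ h f); lin
      | |- is_linear (fun x => sweedler ?D (@?g x) ?f) =>
          apply: (@is_linear_sweedler_arg _ _ D _ _ g f); lin
      | |- is_linear (fun x => \sum_(i <- ?r) @?f i x) =>
          apply: (@is_linear_big _ _ _ _ r f); lin
      | HG : is_linear ?G |- is_linear (fun x => ?G (@?f x)) =>
          apply: (is_linear_comp HG (f := f)); lin
      | HF : is_bilinear ?F |- is_linear (?F ?u) => exact: (proj2 HF u)
      | HF : is_bilinear ?F |- is_linear (fun x => ?F ?u (@?f x)) =>
          apply: (is_linear_comp (proj2 HF u) (f := f)); lin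
      | HF : is_bilinear ?F |- is_linear (fun x => ?F (@?f x) ?u) =>
          apply: (is_linear_comp (proj1 HF u) (f := f)); lin
      | |- is_linear (fun x => fun_of_lfun ?l (@?f x)) =>
          apply: (is_linear_comp (linearP_is_linear (fun_of_lfun l)) (f := f)); lin
      | |- is_linear (fun x => tensor_lift (fun a b => @?f x a b) ?y) =>
          apply: (@is_linear_lift_fun _ _ _ _ _ y f); lin
      | |- is_linear (fun x => pact ?P (@?f x) ?a) =>
          apply: (is_linear_comp (is_linear_pactl P a) (f := f)); lin
      | |- is_linear (fun x => pact ?P ?h (@?f x)) =>
          apply: (is_linear_comp (is_linear_pactr P h) (f := f)); lin
      | |- is_linear (fun x => antipode_inv ?D (@?f x)) =>
          apply: (is_linear_comp (linearP_is_linear (antipode_inv D)) (f := f)); lin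
      | |- is_linear (fun x => antipode ?D (@?f x)) =>
          apply: (is_linear_comp (linearP_is_linear (antipode D)) (f := f)); lin
      | |- is_linear (fun x => counit ?D (@?f x)) =>
          apply: (is_linear_comp (linearP_is_linear (counit D)) (f := f)); lin
      end
    ].

(** * The Frobenius functional of an integral *)

Section Integral.
Variables (k : fieldType) (H : falgType k) (D : hopfAlgebra H).

Lemma linfun_is_linearE (U V : vectType k) (f : U -> V) :
  is_linear f -> linfun f =1 f.
Proof.
move=> fL; pose isl := GRing.isLinear.Build k U V *:%R f fL.
by pose F : {linear U -> V} := HB.pack f isl; apply: (lfunE F).
Qed.

Definition dual_coord i : dual H := linfun (coord (vbasis {:H}) i : H -> k^o).

Let e i := (vbasis {:H})`_i.
Let ec := dual_coord.

Lemma dual_basisE (h : H) :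
  h = \sum_i (dual_coord i h : k) *: (vbasis {:H})`_i.
Proof.
rewrite {1}(coord_vbasis (memvf h)); apply: eq_bigr => i _.
by rewrite linfun_is_linearE //; apply: linearP_is_linear.
Qed.

Lemma dual_separates (g h : H) : (forall f : dual H, f g = f h) -> g = h.
Proof.
move=> gh; rewrite [g]dual_basisE [h]dual_basisE.
by apply: eq_bigr => i _; rewrite gh.
Qed.

Variable t : H.
Hypotheses (t_neq0 : t <> 0) (t_int : left_integral D t).

(** Both sides equal [S(h_1) h_2 t_1 (x) h_3 t_2]: contracting [S(h_1) h_2] gives the left one, and
    [h_2 t = eps(h_2) t], put under the coproduct, gives the right one. *)
Lemma integral_antipode (V : lmodType k) h (F : H -> H -> V) : is_bilinear F ->
  sweedler D t (fun a b => F a (h * b)) =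
  sweedler D t (fun a b => F (antipode D h * a) b).
Proof.
move=> FB.
transitivity (sweedler D h (fun h1 h2 =>
    sweedler D (h2 * t) (fun a b => F (antipode D h1 * a) b))); last first.
  pose G x := sweedler D t (fun a b => F (antipode D x * a) b).
  have GL : is_linear G by rewrite /G; lin.
  rewrite -[RHS](sweedler_counitr D h GL); apply: eq_sweedler => a b.
  by rewrite t_int (is_linearZ _ _ (is_linear_sweedler D _)) //; lin.
pose G2 x := sweedler D t (fun a b => F a (x * b)).
have G2L : is_linear G2 by rewrite /G2; lin.
rewrite -[LHS](sweedler_counitl D h G2L).
transitivity (sweedler D h (fun h1 h2 => sweedler D h1 (fun c d =>
    sweedler D t (fun a b => F (antipode D c * d * a) (h2 * b))))).
  apply: eq_sweedler => h1 h2.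
  pose G x := sweedler D t (fun a b => F (x * a) (h2 * b)).
  have GL : is_linear G by rewrite /G; lin.
  rewrite [RHS](sweedler_antipodel D h1 GL); congr (_ *: _).
  by apply: eq_sweedler => a b; rewrite mul1r.
rewrite (sweedler_coassoc D h (f := fun c d h2 =>
  sweedler D t (fun a b => F (antipode D c * d * a) (h2 * b)))); last by lin.
apply: eq_sweedler => a b; rewrite sweedlerM; last by lin.
by apply: eq_sweedler => c d; apply: eq_sweedler => x y; rewrite mulrA.
Qed.

Lemma dual_nonzero : exists f : dual H, f t = 1.
Proof.
have [i ti] : exists i, ec i t != 0.
  apply: contrapT => /forallNP ti; apply: t_neq0.
  apply: dual_separates => f; rewrite [t]dual_basisE.
  rewrite big1 ?linear0 // => i _.
  by have /negP := ti i; rewrite negbK => /eqP ->; rewrite scale0r.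
by exists ((ec i t)^-1 *: ec i); rewrite lfunE /= [_ *: _]mulVf.
Qed.

(* The span of the elements f(t_1) t_2 is a left ideal by integral_antipode and
   contains f(t_1) S(t_2) t_3 = f(t) 1. *)
Lemma frobenius_functional :
  exists lam : dual H, sweedler D t (fun a b => (lam a : k) *: b) = 1.
Proof.
have [f ft] := dual_nonzero.
pose T x := sweedler D x (fun a b => (f a : k) *: antipode D b).
have TL : is_linear T by rewrite /T; lin.
(* [l x] is the trace of [y |-> T(S(y) x)]. In [l(t_1) t_2], [integral_antipode] turns [S(e_i)] into
   a factor [e_i] on [t_2]; summing over the basis leaves
   [T(t_1) t_2 = f(t_1) S(t_2) t_3 = f(t) 1]. *)
pose l x : k^o := \sum_i ec i (T (antipode D (e i) * x)).
have lL : is_linear l by rewrite /l; lin.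
exists (linfun l).
transitivity (sweedler D t (fun a b => T a * b)).
  transitivity (\sum_i sweedler D t (fun a b => (ec i (T (antipode D (e i) * a)) : k) *: b)).
    rewrite /sweedler /tensor_lift exchange_big; apply: eq_bigr => p _.
    by rewrite linfun_is_linearE // scaler_suml.
  transitivity (\sum_i sweedler D t (fun a b => (ec i (T a) : k) *: (e i * b))).
    apply: eq_bigr => i _.
    rewrite [RHS](integral_antipode (e i) (F := fun a b => (ec i (T a) : k) *: b)) //.
    by lin.
  rewrite /sweedler /tensor_lift exchange_big; apply: eq_bigr => p _.
  rewrite [in RHS](dual_basisE (T p.1)) mulr_suml.
  by apply: eq_bigr => i _; rewrite scalerAl.
transitivity (sweedler D t (fun a b => sweedler D a (fun a1 a2 =>
    (f a1 : k) *: (antipode D a2 * b)))).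
  apply: eq_sweedler => a b; rewrite /T.
  rewrite (sweedler_linear D (G := fun x => x * b)); last by lin.
  by apply: eq_sweedler => x y; rewrite scalerAl.
rewrite (sweedler_coassoc D t (f := fun a b c => (f a : k) *: (antipode D b * c))); last by lin.
rewrite -[RHS]scale1r -ft.
transitivity (sweedler D t (fun a b =>
    (counit D b : k) *: ((f a : k) *: (1 : H)))); last first.
  by rewrite (sweedler_counitr D t (G := fun x => (f x : k) *: (1 : H))) //; lin.
apply: eq_sweedler => a b.
rewrite (sweedler_antipodel D b (G := fun x => (f a : k) *: x)) //; lin.
Qed.

End Integral.

Lemma dim_dual (k : fieldType) (H : falgType k) : \dim {:dual H} = \dim {:H}.
Proof.
rewrite !dimvf; rewrite /dim /=.
by rewrite muln1.
Qed.

(** * Bijectivity of the antipode and dual bases from the Frobenius functional *)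

Section Frobenius.
Variables (k : fieldType) (H : falgType k) (D : hopfAlgebra H) (t : H).
Hypothesis t_int : left_integral D t.
Variable lam : dual H.
Hypothesis lam_t : sweedler D t (fun a b => (lam a : k) *: b) = 1.

(** Moving [S(h)] across the integral leaves [lam(t_1) h t_2 = h]. Since [h] is thus recovered from
    [S(h)], the antipode is injective. *)
Lemma frobenius_antipode h :
  sweedler D t (fun a b => (lam (antipode D h * a) : k) *: b) = h.
Proof.
rewrite -(integral_antipode t_int h (F := fun a b => (lam a : k) *: b)); last by lin.
rewrite -[RHS]mulr1 -lam_t (sweedler_linear D (G := fun x => h * x)); last by lin.
by apply: eq_sweedler => a b; rewrite scalerAr.
Qed.

Lemma antipode_ker : lker (linfun (antipode D)) == 0%VS.
Proof.
apply/lker0P => g h; rewrite !lfunE /= => gh.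
by rewrite -[g]frobenius_antipode -[h]frobenius_antipode gh.
Qed.

Lemma antipodeK : cancel (antipode_inv D) (antipode D).
Proof.
by move=> h; have := lker0_lfunVK antipode_ker h; rewrite [X in X = _]lfunE.
Qed.

Lemma antipode_invE g :
  antipode_inv D g = sweedler D t (fun a b => (lam (g * a) : k) *: b).
Proof. by rewrite -{2}[g]antipodeK frobenius_antipode. Qed.

(** By [antipode_invE], [h_2 S^-1(h_1) = lam(h_1 t_1) h_2 t_2], which is the slice by [lam] of the
    coproduct of [h t = eps(h) t]. *)
Lemma sweedler_antipode_inv (V : lmodType k) h (G : H -> V) : is_linear G ->
  sweedler D h (fun a b => G (b * antipode_inv D a)) = (counit D h : k) *: G 1.
Proof.
move=> GL; rewrite -(sweedler_linear D (G := G)) // -(is_linearZ _ _ GL).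
congr (G _).
transitivity (sweedler D (h * t) (fun a b => (lam a : k) *: b)).
  rewrite sweedlerM; last by lin.
  apply: eq_sweedler => a b; rewrite antipode_invE.
  rewrite (sweedler_linear D (G := fun x => b * x)); last by lin.
  by apply: eq_sweedler => c d; rewrite scalerAr.
rewrite t_int (is_linearZ _ _ (is_linear_sweedler D _)) ?lam_t //; lin.
Qed.

(** The right-hand counterpart of [integral_antipode]: both sides equal
    [t_1 h_2 S^-1(h_1) (x) t_2 h_3], by [sweedler_antipode_inv] and by [t h_2 = alpha(h_2) t]. The
    resulting twist is the one in [smash_ract]. *)
Lemma integral_modular (alpha : {lrmorphism H -> k^o}) (V : lmodType k) h
    (F : H -> H -> V) :
    (forall h, t * h = (alpha h : k) *: t) -> is_bilinear F ->
  sweedler D t (fun a b => F a (b * h)) =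
  sweedler D h (fun h1 h2 => (alpha h2 : k) *:
    sweedler D t (fun a b => F (a * antipode_inv D h1) b)).
Proof.
move=> alphaE FB.
pose F3 x y z := sweedler D t (fun a b => F (a * (y * antipode_inv D x)) (b * z)).
have F3L : is_trilinear F3 by rewrite /F3; lin.
pose G2 x := sweedler D t (fun a b => F a (b * x)).
have G2L : is_linear G2 by rewrite /G2; lin.
rewrite -[LHS](sweedler_counitl D h G2L).
transitivity (sweedler D h (fun h1 h2 => sweedler D h1 (fun c d => F3 c d h2))).
  apply: eq_sweedler => h1 h2.
  pose G x := sweedler D t (fun a b => F (a * x) (b * h2)).
  have GL : is_linear G by rewrite /G; lin.
  rewrite [RHS](sweedler_antipode_inv h1 GL); congr (_ *: _).
  by apply: eq_sweedler => a b; rewrite mulr1.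
rewrite (sweedler_coassoc D h F3L); apply: eq_sweedler => h1 h2.
pose E a b := F (a * antipode_inv D h1) b.
have EB : is_bilinear E by rewrite /E; lin.
rewrite -[RHS](is_linearZ _ _ (is_linear_sweedler D EB)) -alphaE.
rewrite sweedlerM // sweedler_exchange.
by apply: eq_sweedler => a b; apply: eq_sweedler => c d; rewrite /E mulrA.
Qed.

Definition frobenius_form h : dual H := linfun (fun x => lam (antipode D h * x)).

Lemma frobenius_formE h x : frobenius_form h x = lam (antipode D h * x).
Proof. by rewrite /frobenius_form linfun_is_linearE //; lin. Qed.

(** The map [g |-> lam(S(g) -)] is injective by [frobenius_antipode], hence onto the dual by
    dimension. Writing [f = lam(S(g) -)], the same lemma gives [g = f(t_1) t_2]. *)
Lemma frobenius_dual (f : dual H) h :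
  f h = sweedler D t (fun a b => f a * lam (antipode D b * h) : k^o).
Proof.
pose phi := frobenius_form.
have phiL : is_linear phi.
  move=> c x y; apply/lfunP => z; rewrite !lfunE /= lfunE /= !frobenius_formE.
  by rewrite linearP mulrDl linearD -scalerAl linearZ.
have ker_phi : lker (linfun phi) == 0%VS.
  apply/lker0P => x y; rewrite !linfun_is_linearE // => xy.
  rewrite -[x]frobenius_antipode -[y]frobenius_antipode.
  apply: eq_sweedler => a b; have := congr1 (fun f : dual H => f a) xy.
  by rewrite !frobenius_formE => ->.
have : f \in limg (linfun phi).
  suff -> : limg (linfun phi) = fullv by apply: memvf.
  apply/eqP; rewrite eqEdim subvf /= limg_dim_eq ?dim_dual //.
  by rewrite (eqP ker_phi) capv0.
case/memv_imgP => g _; rewrite linfun_is_linearE // => fE.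
have fP x : f x = lam (antipode D g * x) by rewrite fE frobenius_formE.
rewrite fP -[in LHS](frobenius_antipode g).
rewrite (sweedler_linear D (G := fun x => lam (antipode D x * h) : k^o)); last by lin.
apply: eq_sweedler => a b; rewrite fP linearZ /= -scalerAl linearZ //.
Qed.

(** Functionals separate points, so [frobenius_dual] amounts to [h = lam(S(t_2) h) t_1]: the two
    legs of the integral act as dual bases for [lam(S(-) -)]. *)
Lemma frobenius_expansion (V : lmodType k) (G : H -> V) h : is_linear G ->
  sweedler D t (fun a b => (lam (antipode D b * h) : k) *: G a) = G h.
Proof.
move=> GL; transitivity (G (sweedler D t (fun a b => (lam (antipode D b * h) : k) *: a))).
  rewrite (sweedler_linear D (G := G)) //.
  by apply: eq_sweedler => a b; rewrite (is_linearZ _ _ GL).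
congr (G _); apply: dual_separates => f; rewrite [RHS]frobenius_dual.
rewrite (sweedler_linear D (G := f)); last exact: linearP_is_linear.
by apply: eq_sweedler => a b; rewrite linearZ /= [_ *: _]mulrC.
Qed.
End Frobenius.

(** * Partial actions and the canonical map *)

Section PartialActionTheory.
Variables (k : fieldType) (H : falgType k) (D : hopfAlgebra H) (A : algType k).
Variable P : partialAction D A.
Implicit Types (g h : H).

Lemma pactM_unit h a b :
  sweedler D h (fun h1 h2 => P h1 a * (P h2 1 * b)) = P h a * b.
Proof.
rewrite -[in RHS](mulr1 a) pactM (sweedler_linear D (G := fun x => x * b)); last by lin.
by apply: eq_sweedler => x y; rewrite mulrA.
Qed.

(** Beside a factor [h_1 . a] the partial action composes like a global one: that factor absorbs the
    term [h_2 . 1] produced by [pactA]. *)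
Lemma pactM_pact h g a b :
  sweedler D h (fun h1 h2 => P h1 a * P h2 (P g b)) =
  sweedler D h (fun h1 h2 => P h1 a * P (h2 * g) b).
Proof.
transitivity (sweedler D h (fun h1 h2 => sweedler D h1 (fun x y =>
    P x a * (P y 1 * P (h2 * g) b)))); last first.
  by apply: eq_sweedler => h1 h2; rewrite pactM_unit.
rewrite (sweedler_coassoc D h (f := fun x y z => P x a * (P y 1 * P (z * g) b))); last by lin.
apply: eq_sweedler => h1 h2; rewrite pactA.
by rewrite (sweedler_linear D (G := fun x => P h1 a * x)) //; lin.
Qed.

(** Symmetry places the term [h_2 . 1] to the right of the composed factor, where [h_3 . b] absorbs
    it. *)
Lemma pact_pactM h g a b : symmetric_action P ->
  sweedler D h (fun h1 h2 => P h1 (P g a) * P h2 b) =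
  sweedler D h (fun h1 h2 => P (h1 * g) a * P h2 b).
Proof.
move=> P_sym.
transitivity (sweedler D h (fun h1 h2 => sweedler D h1 (fun x y =>
    P (x * g) a * (P y 1 * P h2 b)))).
  apply: eq_sweedler => h1 h2; rewrite P_sym.
  rewrite (sweedler_linear D (G := fun x => x * P h2 b)); last by lin.
  by apply: eq_sweedler => x y; rewrite mulrA.
rewrite (sweedler_coassoc D h (f := fun x y z => P (x * g) a * (P y 1 * P z b))); last by lin.
apply: eq_sweedler => h1 h2; rewrite -[in RHS](mul1r b) pactM.
by rewrite (sweedler_linear D (G := fun x => P (h1 * g) a * x)) //; lin.
Qed.

(** The right side expands to [(h_1 . a)(h_2 S(h_3) . b)] by [pactM_pact], and the antipode axiom
    collapses it. It serves to bring a product under a single application of [P]. *)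
Lemma pact_mul_antipode h a b :
  P h a * b = sweedler D h (fun h1 h2 => P h1 (a * P (antipode D h2) b)).
Proof.
transitivity (sweedler D h (fun h1 h2 => sweedler D h1 (fun x y =>
    P x a * P (y * antipode D h2) b))); last first.
  by apply: eq_sweedler => h1 h2; rewrite pactM pactM_pact.
rewrite (sweedler_coassoc D h (f := fun x y z => P x a * P (y * antipode D z) b)); last by lin.
pose G x := P x a * b; have GL : is_linear G by rewrite /G; lin.
rewrite -[LHS](sweedler_counitr D h GL); apply: eq_sweedler => h1 h2.
rewrite (sweedler_antipoder D h2 (G := fun x => P h1 a * P x b)) ?pact1 //; lin.
Qed.

Lemma invariants_pactM h c b : invariants P c -> P h (c * b) = c * P h b.
Proof.
move=> cI; rewrite -[in RHS](mul1r b) !pactM.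
rewrite (sweedler_linear D (G := fun x => c * x)); last by lin.
by apply: eq_sweedler => x y; rewrite cI mulrA.
Qed.

(** [pactA] and [h_2 t = eps(h_2) t] give [h . (t . a) = (h . 1)(t . a)]; centrality exchanges the
    factors. *)
Lemma integral_invariants t a : left_integral D t ->
  (forall h a, P h 1 * a = a * P h 1) -> invariants P (P t a).
Proof.
move=> t_int P_central h; rewrite pactA -P_central.
transitivity (sweedler D h (fun h1 h2 => (counit D h2 : k) *: (P h1 1 * P t a))).
  apply: eq_sweedler => x y; rewrite t_int (is_linearZ _ _ (is_linear_pactl P a)).
  by rewrite scalerAr.
by rewrite (sweedler_counitr D h (G := fun x => P x 1 * P t a)) //; lin.
Qed.

(** For [x = a (x) h] and [u = b a], [t . (u (h . c)) = (t_1 . u)(t_2 h . c)]. Then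
    [integral_modular] moves [h] to the left factor, and symmetry recombines the result into
    [alpha(h_2) t . ((S^-1(h_1) . u) c)]. *)
Lemma morita_pairing_balanced (t : H) (alpha : {lrmorphism H -> k^o}) (lam : dual H) :
    left_integral D t -> sweedler D t (fun x y => (lam x : k) *: y) = 1 ->
    (forall h, t * h = (alpha h : k) *: t) -> symmetric_action P ->
  balanced (fun (a : A) (x : {x | smash P x}) => smash_ract P alpha a (sval x))
    (fun (x : {x | smash P x}) b => smash_lact P (sval x) b)
    (fun a b => P t (a * b)).
Proof.
move=> t_int lam_t alphaE P_sym.
have PL := is_linear_pactr P t.
split=> [a a' b|a b b'|b x c].
- by rewrite mulrDl (is_linearD PL).
- by rewrite mulrDr (is_linearD PL).
have alphaL : is_linear alpha by apply: linearP_is_linear.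
rewrite /smash_ract /smash_lact; move: (sval x) => {}x.
rewrite [in LHS]/tensor_lift [in RHS]/tensor_lift mulr_suml mulr_sumr.
rewrite !(is_linear_sum _ _ PL); apply: eq_bigr => -[a h] _ /=.
rewrite (sweedler_linear D (G := fun x => P t (x * c))); last by lin.
rewrite mulrA; move: (b * a) => {a b}u.
rewrite [RHS]pactM pactM_pact.
rewrite (integral_modular t_int lam_t h (F := fun x y => P x u * P y c) alphaE); last by lin.
apply: eq_sweedler => h1 h2.
by rewrite -scalerAl (is_linearZ _ _ PL) pactM pact_pactM.
Qed.

(** * Elements of [A (x) H^*] viewed as linear maps from [H] to [A] *)

Definition eval_at h (x : ktensor A (dual H)) : A :=
  tensor_lift (fun a (f : dual H) => (f h : k) *: a) x.

Lemma eval_at_bilinear h : is_bilinear (fun (a : A) (f : dual H) => (f h : k) *: a).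
Proof.
split=> [f|a]; first by lin.
by move=> c f g; rewrite lfunE /= lfunE scalerDl scalerA.
Qed.

Lemma eval_at_linear h : is_linear (eval_at h).
Proof. exact/is_linear_lift/eval_at_bilinear. Qed.

Lemma eval_at_ktens h a (f : dual H) : eval_at h (ktens a f) = (f h : k) *: a.
Proof. exact/lift_ktens/eval_at_bilinear. Qed.

Lemma eval_at_linear_arg x : is_linear (eval_at^~ x).
Proof. by rewrite /eval_at; lin. Qed.

Lemma eval_at_expansion (x : ktensor A (dual H)) :
  x = \sum_(i < \dim {:H}) ktens (eval_at (vbasis {:H})`_i x) (dual_coord i).
Proof.
elim/ktensor_ind: x => [|a f x {1}->].
  rewrite big1 // => i _; rewrite (is_linear0 (eval_at_linear _)).
  by apply: (is_linear0 (proj1 (is_bilinear_ktens _ _) _)).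
under [RHS]eq_bigr => i _ do
  rewrite (is_linearD (eval_at_linear _)) ktensDl eval_at_ktens ktensZ.
rewrite big_split /=; congr (_ + _).
rewrite -(is_linear_sum _ _ (proj2 (is_bilinear_ktens _ _) a)); congr (ktens a _).
apply/lfunP => h; rewrite {1}[h]dual_basisE linear_sum sum_lfunE.
by apply: eq_bigr => i _; rewrite scale_lfunE linearZ; apply: mulrC.
Qed.

Lemma eval_at_inj x y : (forall h, eval_at h x = eval_at h y) -> x = y.
Proof.
move=> xy; rewrite [x]eval_at_expansion [y]eval_at_expansion.
by apply: eq_bigr => i _; rewrite xy.
Qed.

Lemma eval_at_coaction h b : eval_at h (coaction P b) = P h b.
Proof.
rewrite /coaction (is_linear_sum _ _ (eval_at_linear h)) [in RHS](dual_basisE h).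
rewrite (is_linear_sum _ _ (is_linear_pactl P b)); apply: eq_bigr => i _.
by rewrite eval_at_ktens (is_linearZ _ _ (is_linear_pactl P b)).
Qed.

Lemma eval_at_lmul h a x : eval_at h (coact_lmul a x) = a * eval_at h x.
Proof.
rewrite /coact_lmul {1}/tensor_lift (is_linear_sum _ _ (eval_at_linear h)).
rewrite mulr_sumr; apply: eq_bigr => p _.
by rewrite eval_at_ktens scalerAr.
Qed.

Lemma convolutionE (f g : dual H) h :
  convolution D f g h = sweedler D h (fun h1 h2 => f h1 * g h2 : k^o).
Proof.
rewrite /convolution linfun_is_linearE //; apply: is_linear_sweedler.
split=> v x y z; first by rewrite linearP mulrDl scalerAl.
by rewrite linearP mulrDr scalerAr.
Qed.

(** Under evaluation, the right action of [b] is convolution with [h |-> h . b], because the product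
    of [H^*] is dual to [comul]. *)
Lemma eval_at_rmul h x b :
  eval_at h (coact_rmul P x b) =
  sweedler D h (fun h1 h2 => eval_at h1 x * P h2 b).
Proof.
have -> : sweedler D h (fun h1 h2 => eval_at h1 x * P h2 b) =
    sweedler D h (fun h1 h2 => eval_at h1 x * eval_at h2 (coaction P b)).
  by apply: eq_sweedler => h1 h2; rewrite eval_at_coaction.
rewrite /coact_rmul; move: (coaction P b) => y.
rewrite {1}/tensor_lift (is_linear_sum _ _ (eval_at_linear h)).
transitivity (\sum_(p <- repr x) sweedler D h (fun h1 h2 =>
    (p.2 h1 : k) *: p.1 * eval_at h2 y)); last first.
  rewrite /sweedler {1}/tensor_lift exchange_big; apply: eq_bigr => p _.
  by rewrite -mulr_suml.
apply: eq_bigr => -[a f] _ /=.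
rewrite {1}/tensor_lift (is_linear_sum _ _ (eval_at_linear h)).
transitivity (\sum_(q <- repr y) sweedler D h (fun h1 h2 =>
    (f h1 : k) *: a * ((q.2 h2 : k) *: q.1))).
  apply: eq_bigr => -[c g] _ /=; rewrite eval_at_ktens convolutionE.
  rewrite /sweedler /tensor_lift scaler_suml; apply: eq_bigr => p _.
  by rewrite -scalerAl -scalerAr scalerA.
rewrite /sweedler {1}/tensor_lift exchange_big; apply: eq_bigr => p _.
by rewrite -mulr_sumr.
Qed.

(** * The canonical map: well-definedness, bimodule property and codomain *)

Lemma invariants_balanced :
  balanced (fun a (c : {c : A | invariants P c}) => a * sval c)
    (fun (c : {c : A | invariants P c}) b => sval c * b)
    (fun a b => coact_lmul a (coaction P b)).
Proof.
split=> [a a' b|a b b'|a [c cI] b]; apply: eval_at_inj => h;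
  rewrite ?(is_linearD (eval_at_linear h)) !eval_at_lmul !eval_at_coaction.
- by rewrite mulrDl.
- by rewrite (is_linearD (is_linear_pactr P h)) mulrDr.
- by rewrite /= invariants_pactM // mulrA.
Qed.

Lemma eval_at_galois h (x : invariants_tensor P) :
  eval_at h (galois_map x) = \sum_(p <- repr x) p.1 * P h p.2.
Proof.
rewrite /galois_map /tensor_lift (is_linear_sum _ _ (eval_at_linear h)).
by apply: eq_bigr => p _; rewrite eval_at_lmul eval_at_coaction.
Qed.

Lemma galois_mapD : {morph @galois_map _ _ _ _ P : x y / x + y}.
Proof. exact/tensor_liftD/invariants_balanced. Qed.

Lemma galois_map_tens a b :
  galois_map (tens a b : invariants_tensor P) = coact_lmul a (coaction P b).
Proof. exact/tensor_lift_tens/invariants_balanced. Qed.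

Lemma galois_map_sum I (r : seq I) (E : I -> invariants_tensor P) :
  galois_map (\sum_(i <- r) E i) = \sum_(i <- r) galois_map (E i).
Proof.
rewrite (big_morph _ galois_mapD (_ : _ = 0)) //.
by apply: (addIr (galois_map (0 : invariants_tensor P))); rewrite -galois_mapD !add0r.
Qed.

Lemma galois_map_lmul a (x : invariants_tensor P) :
  galois_map (invariants_lmul a x) = coact_lmul a (galois_map x).
Proof.
apply: eval_at_inj => h; rewrite eval_at_lmul [in RHS]eval_at_galois /invariants_lmul.
rewrite {1}/tensor_lift [X in eval_at h X]galois_map_sum.
rewrite (is_linear_sum _ _ (eval_at_linear h)).
rewrite mulr_sumr; apply: eq_bigr => p _.
by rewrite galois_map_tens eval_at_lmul eval_at_coaction mulrA.
Qed.

Lemma galois_map_rmul (x : invariants_tensor P) a :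
  galois_map (invariants_rmul x a) = coact_rmul P (galois_map x) a.
Proof.
apply: eval_at_inj => h; rewrite eval_at_rmul /invariants_rmul.
rewrite {1}/tensor_lift [X in eval_at h X]galois_map_sum.
rewrite (is_linear_sum _ _ (eval_at_linear h)).
transitivity (\sum_(p <- repr x) sweedler D h (fun h1 h2 =>
    p.1 * P h1 p.2 * P h2 a)).
  apply: eq_bigr => p _; rewrite galois_map_tens eval_at_lmul eval_at_coaction pactM.
  rewrite (sweedler_linear D (G := fun x => p.1 * x)); last by lin.
  by apply: eq_sweedler => h1 h2; rewrite mulrA.
rewrite exchange_big; apply: eq_bigr => q _.
by rewrite eval_at_galois mulr_suml.
Qed.

Lemma galois_map_coact_bimodule (x : invariants_tensor P) :
  coact_bimodule P (galois_map x).
Proof.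
(* The element is its own preimage: right multiplication by 1 fixes it, as
   [h . b = (h_1 . b)(h_2 . 1)]. *)
exists (galois_map x) => //; apply: eval_at_inj => h.
rewrite eval_at_rmul eval_at_galois.
transitivity (\sum_(p <- repr x) sweedler D h (fun h1 h2 =>
    p.1 * P h1 p.2 * P h2 1)).
  rewrite exchange_big; apply: eq_bigr => q _.
  by rewrite eval_at_galois mulr_suml.
apply: eq_bigr => p _; rewrite -[in RHS](mulr1 p.2) pactM.
rewrite (sweedler_linear D (G := fun x => p.1 * x)); last by lin.
by apply: eq_sweedler => h1 h2; rewrite mulrA.
Qed.

(** * The partial smash product and its comparison with [A (x) H^*] *)

Lemma smash_mul_ktens a h b g :
  smash_mul P (ktens a h) (ktens b g) =
  sweedler D h (fun h1 h2 => ktens (a * P h1 b) (h2 * g)).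
Proof.
rewrite /smash_mul lift_ktens; last by lin.
by rewrite lift_ktens //; lin.
Qed.

Lemma smash_mul_linear y : is_linear (fun x => smash_mul P x y).
Proof. by apply: is_linear_lift; lin. Qed.

Lemma smash_mul_linearr x : is_linear (smash_mul P x).
Proof. by apply: is_linear_big => p; apply: is_linear_lift; lin. Qed.

Section Frobenius.
Variables (t : H) (lam : dual H).
Hypothesis t_int : left_integral D t.
Hypothesis lam_t : sweedler D t (fun a b => (lam a : k) *: b) = 1.

(** This is the map [Theta] of the opening outline. *)
Definition frobenius_map (x : ktensor A (dual H)) : ktensor A H :=
  sweedler D t (fun t1 t2 => ktens (eval_at t1 x) t2).

Lemma frobenius_map_linear : is_linear frobenius_map.
Proof.
apply: is_linear_sweedler_fun => a b.
exact: (is_linear_ktensl b (eval_at_linear a)).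
Qed.

(** This is [frobenius_expansion] for the linear map [h |-> eval_at h x]; it reconstructs [x] from
    its image. *)
Lemma eval_at_frobenius_map h x :
  eval_at h x =
  tensor_lift (fun a g => (lam (antipode D g * h) : k) *: a) (frobenius_map x).
Proof.
have FB : is_bilinear (fun (a : A) g => (lam (antipode D g * h) : k) *: a).
  split=> u; first by lin.
  by move=> c x' y; rewrite !linearP mulrDl -scalerAl linearP scalerDl scalerA.
rewrite /frobenius_map (sweedler_linear _ _ _ (is_linear_lift FB)).
rewrite -(frobenius_expansion t_int lam_t h (eval_at_linear_arg x)).
by apply: eq_sweedler => a b; rewrite lift_ktens.
Qed.

Lemma frobenius_map_inj : injective frobenius_map.
Proof.
by move=> x y xy; apply: eval_at_inj => h; rewrite !eval_at_frobenius_map xy.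
Qed.

Lemma frobenius_map_surj y : exists x, frobenius_map x = y.
Proof.
have FL := frobenius_map_linear.
elim/ktensor_ind: y => [|a h y [x xy]]; first by exists 0; rewrite (is_linear0 FL).
(* Slicing the integral by [lam(S(h) -)] returns [h], by [frobenius_antipode]. *)
exists (ktens a (frobenius_form D lam h) + x).
rewrite (is_linearD FL) xy; congr (_ + _); rewrite -{2}(frobenius_antipode t_int lam_t h).
rewrite (sweedler_linear _ _ _ (proj2 (is_bilinear_ktens A H) a)).
apply: eq_sweedler => x1 x2.
by rewrite eval_at_ktens frobenius_formE ktensZ.
Qed.

(** Both sides are [x(t_1)(t_2 . 1) (x) t_3], by coassociativity. Multiplication by the unit cuts
    out both [coact_bimodule] and [smash], so these subspaces correspond. *)
Lemma frobenius_map_rmul x :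
  frobenius_map (coact_rmul P x 1) = smash_mul P (frobenius_map x) (ktens 1 1).
Proof.
have EL := eval_at_linear_arg x.
rewrite [in RHS]/frobenius_map (sweedler_linear _ _ _ (smash_mul_linear _)).
transitivity (sweedler D t (fun a b => sweedler D a (fun u v =>
    ktens (eval_at u x * P v 1) b))).
  apply: eq_sweedler => a b; rewrite eval_at_rmul.
  by rewrite (sweedler_linear D (G := fun x => ktens x b)) //; lin.
rewrite (sweedler_coassoc D t (f := fun u v b => ktens (eval_at u x * P v 1) b)); last first.
  by split=> u v; [apply/is_linear_ktensl/is_linear_mull | |]; lin.
apply: eq_sweedler => a b; rewrite smash_mul_ktens.
by apply: eq_sweedler => u v; rewrite mulr1.
Qed.

(** Both sides are sums over the same representative of [x]. On a pure tensor the triple product is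
    [a (t_1 . 1)(t_2 . b) (x) t_3], and [(t_1 . 1)(t_2 . b)] contracts to [t_1 . b]. *)
Lemma morita_bracketE (x : invariants_tensor P) :
  morita_bracket t x = frobenius_map (galois_map x).
Proof.
rewrite [galois_map x]/(tensor_lift _ x) /morita_bracket /tensor_lift.
rewrite (is_linear_sum _ _ frobenius_map_linear); apply: eq_bigr => -[a b] _ /=.
have elt1 c : smash_elt P c 1 = ktens c 1.
  rewrite /smash_elt smash_mul_ktens sweedler1; last by lin.
  by rewrite pact1 !mulr1.
rewrite !elt1 [smash_elt P 1 t]smash_mul_ktens.
rewrite (sweedler_linear _ _ _ (smash_mul_linearr _)) (sweedler_linear _ _ _ (smash_mul_linear _)).
transitivity (sweedler D t (fun t1 t2 => sweedler D t2 (fun u v =>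
    ktens (a * (P t1 1 * P u b)) v))).
  apply: eq_sweedler => t1 t2; rewrite smash_mul_ktens sweedler1; last by lin.
  rewrite pact1 !mul1r !mulr1 smash_mul_ktens.
  by apply: eq_sweedler => u v; rewrite mulr1 mulrA.
rewrite -(sweedler_coassoc D t (f := fun t1 u v => ktens (a * (P t1 1 * P u b)) v)); last by lin.
apply: eq_sweedler => t1 t2; rewrite eval_at_lmul eval_at_coaction -{2}(mul1r b) pactM.
by rewrite (sweedler_linear D (G := fun x => ktens (a * x) t2)) //; lin.
Qed.

Lemma frobenius_map_range :
  smash P = frobenius_map @` coact_bimodule P.
Proof.
apply/seteqP; split=> [_ [w _ <-]|_ [_ [w _ <-] <-]].
  have [x <-] := frobenius_map_surj w.
  by exists (coact_rmul P x 1); [exists x | rewrite frobenius_map_rmul].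
by exists (frobenius_map w) => //; rewrite frobenius_map_rmul.
Qed.

Lemma morita_bracket_surj :
  set_surj [set: invariants_tensor P] (smash P) (morita_bracket t) <->
  set_surj [set: invariants_tensor P] (coact_bimodule P) (@galois_map _ _ _ _ P).
Proof.
rewrite frobenius_map_range; split=> surj y.
  move=> yC; have [|x _ xy] := surj (frobenius_map y); first by exists y.
  by exists x => //; apply: frobenius_map_inj; rewrite -morita_bracketE.
case=> z zC <-; have [x _ <-] := surj z zC.
by exists x; rewrite ?morita_bracketE.
Qed.

Lemma galois_map_inj : (forall h a, P h 1 * a = a * P h 1) ->
    set_surj [set: invariants_tensor P] (smash P) (morita_bracket t) ->
  injective (@galois_map _ _ _ _ P).
Proof.
move=> P_central surj.
(* [w] plays the role of [sum a_i (x) b_i] with bracket [1 (x) 1]; the latter lies in [smash P]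
   because multiplying it by itself fixes it. *)
have [|w _ w1] := surj (ktens 1 1).
  exists (ktens 1 1) => //; rewrite smash_mul_ktens sweedler1; last by lin.
  by rewrite pact1 !mulr1.
(* Both sides have image [1 (x) 1] under the injective [frobenius_map], by the choice of [lam]. *)
have galois_w : galois_map w = ktens 1 lam.
  apply: frobenius_map_inj; rewrite -morita_bracketE w1 -lam_t.
  rewrite (sweedler_linear _ _ _ (proj2 (is_bilinear_ktens A H) 1)).
  by apply: eq_sweedler => x y; rewrite eval_at_ktens ktensZ.
have dual_w h : \sum_(p <- repr w) p.1 * P h p.2 = (lam h : k) *: 1.
  by rewrite -eval_at_galois galois_w eval_at_ktens.
(* [dual_w] has the action on the second factors; [pact_mul_antipode] transfers this to an action on
   the first ones. *)
have lact_w h : \sum_(p <- repr w) P h p.1 * p.2 =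
    sweedler D h (fun h1 h2 => (lam (antipode D h2) : k) *: P h1 1).
  under eq_bigr => p _ do rewrite pact_mul_antipode.
  rewrite exchange_big; apply: eq_bigr => q _.
  have PL := is_linear_pactr P q.1.
  by rewrite -(is_linear_sum _ _ PL) dual_w (is_linearZ _ _ PL).
(* By [lact_w] the sum is [lam(S(t_3)) (t_1 . y)(t_2 . 1) = lam(S(t_2)) (t_1 . y)], and
   [frobenius_expansion] at [h = 1] evaluates this to [1 . y]. *)
have trace_w y : \sum_(p <- repr w) P t (y * p.1) * p.2 = y.
  transitivity (sweedler D t (fun t1 t2 => P t1 y *
      \sum_(p <- repr w) P t2 p.1 * p.2)).
    transitivity (\sum_(p <- repr w) sweedler D t (fun t1 t2 =>
        P t1 y * (P t2 p.1 * p.2))).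
      apply: eq_bigr => p _; rewrite pactM.
      rewrite (sweedler_linear D (G := fun x => x * p.2)); last by lin.
      by apply: eq_sweedler => t1 t2; rewrite mulrA.
    by rewrite exchange_big; apply: eq_bigr => q _; rewrite mulr_sumr.
  transitivity (sweedler D t (fun t1 t2 => sweedler D t2 (fun u v =>
      (lam (antipode D v) : k) *: (P t1 y * P u 1)))).
    apply: eq_sweedler => t1 t2; rewrite lact_w.
    rewrite (sweedler_linear D (G := fun x => P t1 y * x)); last by lin.
    by apply: eq_sweedler => u v; rewrite scalerAr.
  rewrite -(sweedler_coassoc D t (f := fun t1 u v =>
    (lam (antipode D v) : k) *: (P t1 y * P u 1))); last by lin.
  rewrite -[RHS](pact1 P) -(frobenius_expansion t_int lam_t 1 (is_linear_pactl P y)).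
  apply: eq_sweedler => t1 t2; rewrite mulr1 -[y in RHS]mulr1 pactM.
  by rewrite (sweedler_linear D (G := fun x => (lam (antipode D t2) : k) *: x)) //; lin.
have [tDl tDr tM] := tens_balanced
  (fun a (c : {c : A | invariants P c}) => a * sval c)
  (fun (c : {c : A | invariants P c}) (b : A) => sval c * b).
have tsuml (I : Type) (r : seq I) (E : I -> A) b :
    (tens (\sum_(i <- r) E i) b : invariants_tensor P) = \sum_(i <- r) tens (E i) b.
  apply: (big_morph (fun a => tens a b : invariants_tensor P)) => [x y|].
    exact: tDl.
  by apply: (addIr (tens 0 b : invariants_tensor P)); rewrite -tDl !add0r.
have tsumr (I : Type) (r : seq I) (E : I -> A) a :
    (tens a (\sum_(i <- r) E i) : invariants_tensor P) = \sum_(i <- r) tens a (E i).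
  apply: (big_morph (fun b => tens a b : invariants_tensor P)) => [x y|].
    exact: tDr.
  by apply: (addIr (tens a 0 : invariants_tensor P)); rewrite -tDr !add0r.
(* On the image of [x (x) y] the left entry is [x (t_1 . y)(t_2 . a_i) = x (t . (y a_i))]. The trace
   is invariant, so it crosses the tensor sign and [trace_w] restores [x (x) y]. *)
pose F (z : ktensor A (dual H)) : invariants_tensor P := \sum_(p <- repr w)
  tens (sweedler D t (fun t1 t2 => eval_at t1 z * P t2 p.1)) p.2.
suff FK : cancel (@galois_map _ _ _ _ P) F by apply: can_inj FK.
move=> z; rewrite [RHS]tensor_reprE.
transitivity (\sum_(p <- repr w) \sum_(q <- repr z)
    (tens (q.1 * P t (q.2 * p.1)) p.2 : invariants_tensor P)).
  apply: eq_bigr => p _; rewrite -tsuml; congr (tens _ p.2).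
  transitivity (\sum_(q <- repr z) sweedler D t (fun t1 t2 =>
      q.1 * P t1 q.2 * P t2 p.1)).
    rewrite exchange_big; apply: eq_bigr => u _.
    by rewrite eval_at_galois mulr_suml.
  apply: eq_bigr => q _; rewrite pactM.
  rewrite (sweedler_linear D (G := fun x => q.1 * x)); last by lin.
  by apply: eq_sweedler => t1 t2; rewrite mulrA.
rewrite exchange_big; apply: eq_bigr => q _.
rewrite -[in RHS](trace_w q.2) tsumr; apply: eq_bigr => p _.
exact: (tM q.1 (exist _ _ (integral_invariants (q.2 * p.1) t_int P_central)) p.2).
Qed.
End Frobenius.

End PartialActionTheory.

Theorem mainTheorem3 (k : fieldType) (H : falgType k) (D : hopfAlgebra H)
    (t : H) (t_neq0 : t <> 0) (t_int : left_integral D t)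
    (alpha : {lrmorphism H -> k^o})
    (alphaE : forall h : H, t * h = (alpha h : k) *: t)
    (A : algType k) (P : partialAction D A)
    (P_sym : symmetric_action P)
    (P_central : forall (h : H) (a : A), P h 1 * a = a * P h 1)
    (t_surj : set_surj [set: A] (invariants P) (P t)) :
  morita_strict P t alpha <-> partial_hopf_galois P.
Proof.
have [lam lam_t] := frobenius_functional t_neq0 t_int.
have bracketP := morita_bracket_surj P t_int lam_t.
split=> [[bracket_surj _]|[_ _ _ [_ _ galois_surj]]].
  (* Additivity and bilinearity hold for every partial action; surjectivity of the bracket is used
     for bijectivity. *)
  split; [exact: galois_mapD|exact: galois_map_lmul|exact: galois_map_rmul|].
  split=> [x _|x y _ _|]; first exact: galois_map_coact_bimodule.
    exact: (galois_map_inj t_int lam_t P_central bracket_surj).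
  exact/bracketP.
split; first exact/bracketP.
(* An invariant is a trace [t . a], hence the pairing of [a] with 1; balancedness lets [tensor_lift]
   be computed on this pure tensor. *)
move=> c /t_surj [a _ <-]; exists (tens a 1) => //.
rewrite -[a in RHS]mulr1; apply: tensor_lift_tens.
exact: (morita_pairing_balanced t_int lam_t alphaE P_sym).
Qed.
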